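(* For every real number $c_1 > 0$ there exist a real number $c_2 > 0$ and an integer $N$ such that for every $n \ge N$ the following holds: if $G$ is a graph with $n$ nodes such that $G$ has no set of at least $c_1 \log_2 n$ nodes on which it is complete and no set of at least $c_1 \log_2 n$ nodes on which it has no edges, then $I(G) \ge 2^{c_2 n}$.
   Context: Graphs are finite, simple and undirected. A subgraph means an induced subgraph: for $W \subseteq V^G$, $G \restriction W$ is the graph on $W$ whose edges are the edges of $G$ with both endpoints in $W$. $I(G)$ denotes the number of induced subgraphs of $G$ up to isomorphism, i.e. the number of isomorphism classes of graphs of the form $G \restriction W$, $W \subseteq V^G$. *)

(* Defs.v *)
From HB Require Import structures.
From mathcomp Require Import all_boot all_order all_algebra.
From mathcomp Require Import boolp reals exp.

Set Implicit Arguments.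
Unset Strict Implicit.
Unset Printing Implicit Defensive.

Import Order.TTheory GRing.Theory Num.Theory.

Record sgraph := SGraph {
  vertex :> finType;
  adj : rel vertex;
  adj_sym : symmetric adj;
  adj_irr : irreflexive adj
}.

Section Induced.
Variables (G : sgraph) (W : {set G}).

Definition induced_vertex : finType := {x : G | x \in W}.

Definition induced_adj : rel induced_vertex :=
  fun x y => adj (val x) (val y).

Lemma induced_adj_sym : symmetric induced_adj.
Proof. by move=> x y; apply: adj_sym. Qed.

Lemma induced_adj_irr : irreflexive induced_adj.
Proof. by move=> x; apply: adj_irr. Qed.

Definition induced : sgraph := SGraph induced_adj_sym induced_adj_irr.

End Induced.

Definition isomorphic (G H : sgraph) : Prop :=
  exists2 f : G -> H, bijective f & forall x y, adj (f x) (f y) = adj x y.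

Lemma isomorphic_refl (G : sgraph) : isomorphic G G.
Proof. by exists id => //; exists id. Qed.

Lemma isomorphic_sym (G H : sgraph) : isomorphic G H -> isomorphic H G.
Proof.
case=> f [g fK gK] fadj; exists g; first by exists f.
by move=> x y; rewrite -fadj !gK.
Qed.

Lemma isomorphic_trans (G H K : sgraph) :
  isomorphic G H -> isomorphic H K -> isomorphic G K.
Proof.
case=> f bf fadj [g bg gadj]; exists (g \o f); first exact: bij_comp.
by move=> x y /=; rewrite gadj fadj.
Qed.

(* Isomorphism classes of induced subgraphs are counted as the blocks of the
   partition of the vertex subsets W by the isomorphism type of induced W. *)
Definition num_induced (G : sgraph) : nat :=
  #|equivalence_partition
      (fun W1 W2 : {set G} => `[< isomorphic (induced W1) (induced W2) >])
      [set: {set G}]|.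

Definition complete_on (G : sgraph) (W : {set G}) : Prop :=
  {in W &, forall x y, x != y -> adj x y}.

Definition edgeless_on (G : sgraph) (W : {set G}) : Prop :=
  {in W &, forall x y, ~~ adj x y}.

Definition log2 (R : realType) (x : R) : R := (ln x / ln 2)%R.

(* Main.v *)
(** Call [trace A x] the set of neighbours of x in A. A set A of size
    O(n / log n) is built greedily so that every further vertex v splits the
    trace classes of A in a very unbalanced way: the potential
    [sum_x log |class of x|] is at most n log n, and adding v lowers it by the
    number of vertices lying in a minority half, so one can stop when all these
    numbers are O(log^2 n).

    If A has linearly many traces, let T be a transversal of the trace classes.
    The sets obtained from A :|: T by removing at most one element from each of
    q = |T| / 3 triples are 4^q in number, while an isomorphism class contains
    at most n^|A| 2^q of them.

    Otherwise most vertices lie in disjoint pieces of constant size L = 4^r,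
    each inside one class. Each vertex splits few pieces, so more than sqrt n of
    the pieces are pairwise completely joined or completely unjoined. Every
    piece contains a homogeneous set of size r, say always a clique; then a
    clique of s pieces yields a clique of size r s, and off-diagonal Ramsey
    applied to the graph of pieces gives a homogeneous set of size c1 log n. *)

Require Import Defs.
From mathcomp Require Import all_boot all_order all_algebra.
From mathcomp Require Import boolp reals exp.
From mathcomp Require Import zify ring lra.

Set Implicit Arguments.
Unset Strict Implicit.
Unset Printing Implicit Defensive.

Import Order.TTheory GRing.Theory Num.Theory.

(** * Subsets and homogeneous sets *)

Lemma subset_of_card (T : finType) (A : {set T}) k :
  k <= #|A| -> exists2 B : {set T}, B \subset A & #|B| = k.
Proof.
move=> kA; exists [set x in take k (enum A)].
  by apply/subsetP=> x; rewrite inE => /mem_take; rewrite mem_enum.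
rewrite cardsE (card_uniqP _) ?take_uniq ?enum_uniq //.
by rewrite size_takel // -cardE.
Qed.

Definition homogeneous (T : finType) (e : rel T) (b : bool) (W : {set T}) :=
  {in W &, forall x y, x != y -> e x y = b}.

Lemma homogeneousU1 (T : finType) (e : rel T) b (v : T) (W : {set T}) :
  symmetric e -> homogeneous e b W -> {in W, forall x, e v x = b} ->
  homogeneous e b (v |: W).
Proof.
move=> es hW vW x y /setU1P[->|xW] /setU1P[->|yW] xy.
- by rewrite eqxx in xy.
- exact: vW.
- by rewrite es; apply: vW.
- exact: hW.
Qed.

(** * Weighted Ramsey bounds *)

Section Ramsey.
Local Open Scope ring_scope.

(** Erdos-Szekeres induction on [s + t]. The condition [x + y <= x * y], that is 1/x + 1/y <= 1,
    makes [x ^+ s * y ^+ t] at least the sum of the bounds for the two pairs with one exponent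
    lowered. *)
Lemma ramsey_weighted (F : realFieldType) (x y : F) (T : finType) (e : rel T) :
  symmetric e -> 1 <= x -> 1 <= y -> x + y <= x * y ->
  forall s t (S : {set T}), x ^+ s * y ^+ t < #|S|.+1%:R ->
  exists2 W : {set T}, W \subset S &
    (homogeneous e true W /\ #|W| = s) \/ (homogeneous e false W /\ #|W| = t).
Proof.
move=> es x1 y1 xy s t.
have hom0 b : homogeneous e b set0 by move=> u v; rewrite inE.
have [k] := ubnP (s + t)%N; elim: k s t => // k IH [|s] [|t] /ltnSE stk S FS.
- by exists set0; rewrite ?sub0set ?cards0; auto.
- by exists set0; rewrite ?sub0set ?cards0; auto.
- by exists set0; rewrite ?sub0set ?cards0; auto.
have [S0|[v vS]] := set_0Vmem S.
  move: FS; rewrite S0 cards0 ltNge.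
  by rewrite (_ : 1%:R <= _) // mulr_ege1 // exprn_ege1.
pose N b := [set z in S :\ v | e v z == b].
(* The successor in the bound absorbs [v], so the sizes add up exactly. *)
have cS : #|S|.+1%:R = #|N true|.+1%:R + #|N false|.+1%:R :> F.
  rewrite -natrD; congr _%:R.
  rewrite (cardsD1 v S) vS -(cardsID [set z | e v z] (S :\ v)) add1n addSn addnS.
  do 2!congr _.+1; congr (_ + _)%N; apply: eq_card => z; rewrite !inE.
    by rewrite eqb_id.
  by rewrite eqbF_neg andbC.
have NS b : N b \subset S :\ v by apply/subsetP=> z; rewrite inE => /andP[].
have vN b : v \notin N b by rewrite !inE eqxx.
have ext b (W : {set T}) : W \subset N b -> homogeneous e b W ->
    homogeneous e b (v |: W) /\ #|v |: W| = #|W|.+1.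
  move=> WN hW; split.
    apply: homogeneousU1 => // z zW.
    by have := subsetP WN _ zW; rewrite inE => /andP[_ /eqP].
  by rewrite cardsU1 (contra (subsetP WN v)).
have subS b (W : {set T}) : W \subset N b -> W \subset S.
  by move=> WN; rewrite (subset_trans WN) // (subset_trans (NS b)) // subD1set.
have vsubS b (W : {set T}) : W \subset N b -> v |: W \subset S.
  by move=> WN; rewrite subUset sub1set vS (subS b).
have [lt1|ge1] := ltP (x ^+ s * y ^+ t.+1) (#|N true|.+1%:R).
  have [|W WN] := IH s t.+1 _ _ lt1; first by move: stk; lia.
  case=> -[hW cW].
    exists (v |: W); first exact: (vsubS true).
    by left; have [? ->] := ext true W WN hW; rewrite cW.
  by exists W; [apply: (subS true)|right].
have [lt2|ge2] := ltP (x ^+ s.+1 * y ^+ t) (#|N false|.+1%:R).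
  have [|W WN] := IH s.+1 t _ _ lt2; first by move: stk; lia.
  case=> -[hW cW].
    by exists W; [apply: (subS false)|left].
  exists (v |: W); first exact: (vsubS false).
  by right; have [? ->] := ext false W WN hW; rewrite cW.
(* If both neighbourhoods are too small, adding their bounds contradicts the size of [S]. *)
have p0 : 0 <= x ^+ s * y ^+ t.
  by rewrite mulr_ge0 // exprn_ge0 //; lra.
have := ler_wpM2l p0 xy.
move: FS ge1 ge2; rewrite cS !exprS.
set X := x ^+ s; set Y := y ^+ t; move=> h1 h2 h3 h4; exfalso.
have h5 : X * Y * (x * y) = x * X * (y * Y) by ring.
by lra.
Qed.

Lemma ramsey_diagonal (T : finType) (e : rel T) (r : nat) (S : {set T}) :
  symmetric e -> (4 ^ r <= #|S|)%N ->
  exists b (W : {set T}), [/\ W \subset S, homogeneous e b W & #|W| = r].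
Proof.
move=> es rS.
have [||||W WS [[h c]|[h c]]] := @ramsey_weighted rat 2 2 T e es _ _ _ r r S.
- by [].
- by [].
- by [].
- by rewrite -exprMn -natrM -natrX ltr_nat ltnS.
- by exists true, W.
- by exists false, W.
Qed.

(** Bernoulli's inequality (1 - 1/N)^j >= 1 - j/N, cleared of denominators. *)
Lemma bernoulli_nat N j : (j <= N -> N ^ j * (N - j) <= N * (N - 1) ^ j)%N.
Proof.
elim: j => [|j IH] jN; first by rewrite !expn0 subn0 mul1n muln1.
rewrite !expnS; have {}IH := IH (ltnW jN).
have h : (N * (N - j.+1) <= (N - 1) * (N - j))%N by move: jN; nia.
apply: (@leq_trans ((N - 1) * (N ^ j * (N - j)))).
  by rewrite -mulnA [leqLHS]mulnCA [leqRHS]mulnCA leq_mul2l h orbT.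
by rewrite [leqRHS]mulnCA leq_mul2l IH orbT.
Qed.

(* The weights are x = 2u and y = 2u / (2u - 1), for which 1/x + 1/y = 1 and
   y ^ u <= 2. *)
Lemma ramsey_offdiagonal (T : finType) (e : rel T) (u s k t : nat)
    (S : {set T}) :
  symmetric e -> (0 < u)%N -> (t <= u * k)%N ->
  ((2 * u) ^ s * 2 ^ k <= #|S|)%N ->
  exists2 W : {set T}, W \subset S &
    (homogeneous e true W /\ #|W| = s) \/ (homogeneous e false W /\ #|W| = t).
Proof.
move=> es u0 tk hS.
pose x : rat := (2 * u)%N%:R; pose z : rat := (2 * u - 1)%N%:R.
have xz : x = z + 1 by rewrite /x /z natr1; congr _%:R; lia.
have z1 : 1 <= z by rewrite /z ler1n; lia.
have z0 : 0 < z by lra.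
have yu : (x / z) ^+ u <= 2.
  rewrite expr_div_n ler_pdivrMr ?exprn_gt0 // /x /z -!natrX -natrM ler_nat.
  have := @bernoulli_nat (2 * u) u (ltac:(lia)).
  rewrite (_ : (2 * u - u = u)%N); last by lia.
  by rewrite -mulnA (mulnCA 2) (mulnC (_ ^ u)%N u) leq_pmul2l.
have y1 : 1 <= x / z by rewrite ler_pdivlMr //; lra.
apply: (@ramsey_weighted rat x (x / z)) => //.
- by rewrite xz; lra.
- rewrite mulrA -(ler_pM2r z0) mulrDl !divfK ?gt_eqF //.
  by rewrite xz; lra.
apply: (@le_lt_trans _ _ #|S|%:R); last by rewrite ltr_nat.
apply: (@le_trans _ _ ((2 * u) ^ s * 2 ^ k)%N%:R); last by rewrite ler_nat.
rewrite natrM !natrX -/x ler_wpM2l ?exprn_ge0 //.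
apply: (@le_trans _ _ ((x / z) ^+ (u * k))); first exact: ler_weXn2l.
by rewrite exprM lerXn2r // ?nnegrE ?exprn_ge0 // divr_ge0 ?ltW //; lra.
Qed.

End Ramsey.

(** * Independent sets in sparse relations and equal pieces of fibres *)

(** The relation is a digraph with out-degrees at most [D]. By double counting some vertex also has
    in-degree at most [D]; keep it, delete its in- and out-neighbours, and recurse. *)
Lemma sparse_independent (T : finType) (e : rel T) D (S : {set T}) :
  {in S, forall x, #|[set y in S | e x y]| <= D} ->
  exists2 I : {set T}, I \subset S &
    {in I &, forall x y, x != y -> ~~ e x y} /\ #|S| <= (2 * D).+1 * #|I|.
Proof.
have [k] := ubnP #|S|; elim: k S => // k IH S /ltnSE cS eD.
have [->|[x0 x0S]] := set_0Vmem S.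
  by exists set0; rewrite ?sub0set ?cards0; split=> // x y; rewrite inE.
have [x xS xD] : exists2 x, x \in S & #|[set y in S | e y x]| <= D.
  apply/exists_inP; apply: contraT; rewrite negb_exists_in => /forall_inP h.
  have : \sum_(x in S) #|[set y in S | e y x]| <= \sum_(x in S) D.
    rewrite (eq_bigr (fun x => \sum_(y in S) (e y x : nat))); last first.
      move=> x _; rewrite -sum1dep_card big_mkcondr /=.
      by apply: eq_bigr => y _; case: (e y x).
    rewrite exchange_big /=; apply: leq_sum => y yS.
    apply: leq_trans (eD y yS); rewrite -sum1dep_card big_mkcondr /=.
    by apply: leq_sum => z _; case: (e y z).
  have : \sum_(x in S) D.+1 <= \sum_(x in S) #|[set y in S | e y x]|.
    by apply: leq_sum => z /h; rewrite -ltnNge.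
  rewrite !sum_nat_const => h1 h2; have := leq_trans h1 h2.
  by rewrite leq_mul2l ltnn orbF (cardsD1 x0) x0S.
pose Q := x |: ([set y in S | e x y] :|: [set y in S | e y x]).
have cQ : #|Q| <= (2 * D).+1.
  rewrite /Q cardsU1; apply: (@leq_trans (1 + (D + D))); last by lia.
  apply: leq_add; first by case: (_ \notin _).
  by apply: leq_trans (leq_card_setU _ _) _; apply: leq_add => //; apply: eD.
have QS : Q \subset S.
  by apply/subsetP=> y; rewrite !inE => /orP[/eqP->|/orP[]/andP[]].
have xQ : x \in Q by rewrite !inE eqxx.
have cSQ : #|S :\: Q| + #|Q| = #|S|.
  by rewrite -(cardsID Q S) (setIidPr QS) addnC.
have Q0 : 0 < #|Q| by rewrite (cardsD1 x) xQ.
have [||I IS [Ii cI]] := IH (S :\: Q).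
- by move: cS; lia.
- move=> y /setDP[yS _]; apply: leq_trans (eD y yS); apply: subset_leq_card.
  by apply/subsetP=> z; rewrite !inE => /andP[/andP[_ ->]].
have xI : x \notin I.
  by apply/negP=> /(subsetP IS); rewrite in_setD xQ.
have IQ y : y \in I -> ~~ e x y && ~~ e y x.
  move=> /(subsetP IS) /setDP[yS]; rewrite !inE yS /= !negb_or.
  by case/and3P=> _ -> ->.
exists (x |: I).
  rewrite subUset sub1set xS /=; apply: subset_trans IS _; exact: subsetDl.
split; last by rewrite cardsU1 xI; lia.
move=> y z /setU1P[->|yI] /setU1P[->|zI]; rewrite ?eqxx //.
- by case/andP: (IQ z zI).
- by case/andP: (IQ y yI).
- exact: Ii.
Qed.

(** Pieces of size [L] are cut off while some fibre has [L] elements left. At the end each of the at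
    most [K] fibres keeps fewer than [L]. *)
Lemma chop_fibers (T U : finType) (h : T -> U) (L K : nat) (S : {set T}) :
  0 < L -> #|h @: S| <= K ->
  exists I : {set {set T}},
    [/\ trivIset I, cover I \subset S,
        {in I, forall X : {set T},
           #|X| = L /\ {in X &, forall x y, h x = h y}} &
        #|S| <= L * #|I| + K * L].
Proof.
move=> L0; have [k] := ubnP #|S|; elim: k S => // k IH S /ltnSE cS hK.
have [|small] := boolP [exists u, L <= #|[set x in S | h x == u]|]; last first.
  exists set0; split.
  - by apply/trivIsetP=> A B; rewrite inE.
  - by rewrite /cover big_set0 sub0set.
  - by move=> X; rewrite inE.
  rewrite cards0 muln0 add0n.
  apply: (@leq_trans (#|h @: S| * L)); last by rewrite leq_mul2r hK orbT.
  rewrite -sum1_card (partition_big_imset h) /= -sum_nat_const.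
  apply: leq_sum => u _; rewrite sum1dep_card.
  by move: small; rewrite negb_exists => /forallP/(_ u); rewrite -ltnNge => /ltnW.
case/existsP=> u /subset_of_card[X XS cX].
have XS' : X \subset S.
  by apply/subsetP=> x /(subsetP XS); rewrite inE => /andP[].
have cSX : #|S :\: X| + L = #|S|.
  by rewrite -cX -(cardsID X S) (setIidPr XS') addnC.
have [||I [tI cI hI nI]] := IH (S :\: X).
- by move: cS; lia.
- by apply: leq_trans hK; apply: subset_leq_card; apply: imsetS; apply: subsetDl.
have XI : [disjoint X & cover I].
  rewrite disjoint_sym; apply: disjointWl cI _.
  by rewrite disjoints_subset setDE subsetIr.
have XnI : X \notin I.
  apply/negP=> XI'; have : X \subset cover I by apply: bigcup_sup.
  move=> /disjointWr/(_ XI); rewrite -setI_eq0 setIid => /eqP X0.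
  by move: cX L0; rewrite X0 cards0 => <-.
exists (X |: I); split.
- apply/trivIsetP=> A B /setU1P[->|AI] /setU1P[->|BI] AB.
  + by rewrite eqxx in AB.
  + by apply: disjointWr XI; apply: bigcup_sup.
  + by rewrite disjoint_sym; apply: disjointWr XI; apply: bigcup_sup.
  + by move/trivIsetP: tI; apply.
- rewrite /cover big_setU1 //= subUset XS' /=.
  by apply: subset_trans cI _; apply: subsetDl.
- move=> Y /setU1P[->|]; last exact: hI.
  split=> // x y /(subsetP XS); rewrite inE => /andP[_ /eqP->].
  by move=> /(subsetP XS); rewrite inE => /andP[_ /eqP->].
- by rewrite cardsU1 XnI -cSX; lia.
Qed.

(** * Trace classes *)

Definition trace (G : sgraph) (A : {set G}) (x : G) : {set G} :=
  [set a in A | adj a x].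

Definition trace_class (G : sgraph) (A : {set G}) (x : G) : {set G} :=
  [set y | trace A y == trace A x].

(** These are the vertices in the smaller part of a class split by [v]. Both parts count in an even
    split, and an unsplit class contributes nothing because classes are nonempty. *)
Definition minority (G : sgraph) (A : {set G}) (v : G) : {set G} :=
  [set x | 2 * #|trace_class (v |: A) x| <= #|trace_class A x|].

Definition potential (G : sgraph) (A : {set G}) : nat :=
  \sum_(x : G) trunc_log 2 #|trace_class A x|.

Lemma trace_eqP (G : sgraph) (A : {set G}) (x y : G) :
  reflect {in A, forall a, adj a x = adj a y} (trace A x == trace A y).
Proof.
apply: (iffP eqP) => [/setP h a aA | h].
  by have := h a; rewrite !inE aA.
by apply/setP=> a; rewrite !inE; case: (boolP (a \in A)) => //= /h ->.
Qed.

Lemma trace_classU1_sub (G : sgraph) (A : {set G}) (v x : G) :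
  trace_class (v |: A) x \subset trace_class A x.
Proof.
apply/subsetP=> y; rewrite !inE => /trace_eqP h; apply/trace_eqP=> a aA.
by apply: h; rewrite !inE aA orbT.
Qed.

Lemma trace_class_gt0 (G : sgraph) (A : {set G}) (x : G) :
  0 < #|trace_class A x|.
Proof. by rewrite (cardsD1 x) inE eqxx. Qed.

(** A class that at least halves loses at least one unit of rounded logarithm; no other term
    grows. *)
Lemma potential_minority (G : sgraph) (A : {set G}) (v : G) :
  potential (v |: A) + #|minority A v| <= potential A.
Proof.
rewrite /potential -[#|minority A v|]sum1_card.
rewrite [X in _ + X]big_mkcond -big_split /=.
apply: leq_sum => x _; rewrite inE; case: ifP => h.
  apply: (@leq_trans (trunc_log 2 (2 * #|trace_class (v |: A) x|))).
    by rewrite trunc_logMp ?trace_class_gt0 // addnC.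
  exact: leq_trunc_log.
by rewrite addn0 leq_trunc_log // subset_leq_card // trace_classU1_sub.
Qed.

Lemma potential_le (G : sgraph) (A : {set G}) :
  potential A <= #|G| * trunc_log 2 #|G|.
Proof.
rewrite /potential -sum_nat_const; apply: leq_sum => x _.
by rewrite leq_trunc_log // max_card.
Qed.

Lemma exists_small_minority (G : sgraph) m g :
  #|G| * trunc_log 2 #|G| < m * g.+1 ->
  exists2 A : {set G}, #|A| <= m & forall v, #|minority A v| <= g.
Proof.
move=> mg.
(* As long as some vertex has a minority above [g], adding it to [A] lowers the potential by at
   least [g.+1]; [mg] forbids [m] such steps. *)
have step k : exists2 A : {set G}, #|A| <= k &
   (forall v, #|minority A v| <= g) \/
   potential A + k * g.+1 <= #|G| * trunc_log 2 #|G|.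
  elim: k => [|k [A cA [?|pA]]].
  - by exists set0; rewrite ?cards0 // addn0; right; apply: potential_le.
  - by exists A; [apply: leqW|left].
  have [/forallP h|] := boolP [forall v, #|minority A v| <= g].
    by exists A; [apply: leqW|left].
  rewrite negb_forall => /existsP[v]; rewrite -ltnNge => gv.
  exists (v |: A); first by rewrite cardsU1; case: (_ \notin _); lia.
  by right; have := potential_minority A v; move: gv pA; lia.
have [A cA [h|h]] := step m; first by exists A.
by exfalso; move: h mg; lia.
Qed.

Definition splits (G : sgraph) (v : G) (X : {set G}) : bool :=
  [exists x in X, exists y in X, adj v x != adj v y].

(** Two vertices of [X] told apart by [v] fall into disjoint parts of their common class, and the
    smaller part has at most half of it. *)
Lemma splits_minority (G : sgraph) (A X : {set G}) (v : G) :
  {in X &, forall x y, trace A x = trace A y} -> splits v X ->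
  exists2 x, x \in X & x \in minority A v.
Proof.
move=> hX /exists_inP[x xX /exists_inP[y yX vxy]].
have cxy : trace_class A x = trace_class A y.
  by apply/setP=> z; rewrite !inE (hX x y).
have dis : [disjoint trace_class (v |: A) x & trace_class (v |: A) y].
  rewrite -setI_eq0; apply/eqP/setP=> z; rewrite !inE.
  apply/negP=> /andP[/trace_eqP/(_ v (setU11 _ _)) h1].
  move=> /trace_eqP/(_ v (setU11 _ _)) h2.
  by rewrite -h1 h2 eqxx in vxy.
have : #|trace_class (v |: A) x| + #|trace_class (v |: A) y|
       <= #|trace_class A x|.
  rewrite -cardsUI (disjoint_setI0 dis) cards0 addn0.
  apply: subset_leq_card; rewrite subUset trace_classU1_sub cxy.
  by rewrite trace_classU1_sub.
have [h|h] := leqP #|trace_class (v |: A) x| #|trace_class (v |: A) y| => le.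
  by exists x => //; rewrite inE; lia.
by exists y => //; rewrite inE -cxy; lia.
Qed.

(** Every split piece contains a minority vertex, and the pieces are disjoint. *)
Lemma card_split_pieces (G : sgraph) (A : {set G}) (I : {set {set G}}) (v : G) :
  trivIset I ->
  {in I, forall X : {set G}, {in X &, forall x y, trace A x = trace A y}} ->
  #|[set X in I | splits v X]| <= #|minority A v|.
Proof.
move=> tI hI; apply: (@leq_trans #|pblock I @: minority A v|); last first.
  exact: leq_imset_card.
apply: subset_leq_card; apply/subsetP=> X; rewrite inE => /andP[XI sX].
have [x xX xm] := splits_minority (hI X XI) sX.
by apply/imsetP; exists x => //; rewrite (def_pblock tI XI xX).
Qed.

(** Each piece is a module with respect to the vertices of the other pieces. *)
Definition separated (G : sgraph) (I : {set {set G}}) :=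
  {in I &, forall X Y : {set G}, X != Y -> {in Y, forall v, ~~ splits v X}}.

Lemma exists_separated (G : sgraph) (A : {set G}) (I : {set {set G}}) L g :
  trivIset I ->
  {in I, forall X : {set G}, {in X &, forall x y, trace A x = trace A y}} ->
  {in I, forall X : {set G}, #|X| = L} ->
  (forall v, #|minority A v| <= g) ->
  exists2 J : {set {set G}}, J \subset I &
    separated J /\ #|I| <= (2 * (L * g)).+1 * #|J|.
Proof.
move=> tI hI LI mg.
(* Out-degrees are at most [L * g]: each of the [L] vertices of [Y] splits at most [g] pieces. *)
pose e (Y X : {set G}) := [exists v in Y, splits v X].
have [|J JI [Jind cJ]] := @sparse_independent _ e (L * g) I.
  move=> Y YI; rewrite -(LI Y YI) -sum_nat_const.
  apply: (@leq_trans #|\bigcup_(v in Y) [set X in I | splits v X]|).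
    apply: subset_leq_card; apply/subsetP=> X; rewrite inE => /andP[XI].
    case/exists_inP=> v vY sX; apply/bigcupP; exists v => //.
    by rewrite inE XI.
  elim/big_ind2: _ => [|B1 n1 B2 n2 h1 h2|v vY]; first by rewrite cards0.
    by apply: leq_trans (leq_card_setU _ _) _; apply: leq_add.
  exact: leq_trans (card_split_pieces _ tI hI) (mg v).
exists J => //; split=> // X Y XJ YJ XY v vY.
have := Jind Y X YJ XJ; rewrite eq_sym => /(_ XY); rewrite negb_exists_in.
by move/forall_inP; apply.
Qed.

(** * Counting isomorphism classes *)

(** Isomorphisms are encoded as total maps on [G], so that maps onto different sets can be compared
    on [A]. *)
Definition embeds (G : sgraph) (W0 W : {set G}) (f : G -> G) :=
  [/\ f @: W0 = W, {in W0 &, injective f} &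
      {in W0 &, forall x y, adj (f x) (f y) = adj x y}].

Lemma isomorphic_embeds (G : sgraph) (W0 W : {set G}) :
  isomorphic (induced W0) (induced W) -> exists f, embeds W0 W f.
Proof.
case=> h [k hK kK] hadj.
pose f x := if insub x is Some u then val (h u : {x : G | x \in W}) else x.
have fE (u : induced W0) : f (val u) = val (h u) by rewrite /f valK.
have lift x : x \in W0 -> exists u : induced W0, val u = x.
  by move=> xW; exists (Sub x xW).
exists f; split.
- apply/setP=> y; apply/imsetP/idP=> [[x /lift[u <-] ->]|yW].
    by rewrite fE; apply: valP.
  exists (val (k (Sub y yW))); first exact: valP.
  by rewrite fE kK.
- move=> x y /lift[u <-] /lift[v <-]; rewrite !fE => /val_inj huv.
  by rewrite (can_inj hK huv).
- by move=> x y /lift[u <-] /lift[v <-]; rewrite !fE; apply: hadj.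
Qed.

Section EmbedsAgree.
Variables (G : sgraph) (A T W0 : {set G}).
Hypothesis injT : {in T &, injective (trace A)}.
Hypothesis AW0 : A \subset W0.
Hypothesis W0AT : W0 \subset A :|: T.

(** Outside [A], points with a common image have equal traces on [A], because both maps preserve
    adjacency and agree there; on [T] the trace is injective. *)
Lemma embeds_agree_inj (W W' : {set G}) (f f' : G -> G) (y y' : G) :
  embeds W0 W f -> embeds W0 W' f' -> {in A, f =1 f'} ->
  y \in W0 -> y' \in W0 -> f y = f' y' -> y = y'.
Proof.
move=> [_ fi fa] [_ f'i f'a] ff' yW yW' fyy'.
have [yA|yA] := boolP (y \in A); first by apply: f'i => //; rewrite -ff' ?fyy'.
have [y'A|y'A] := boolP (y' \in A); first by apply: fi => //; rewrite (ff' y').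
have inT z : z \in W0 -> z \notin A -> z \in T.
  by move=> /(subsetP W0AT) /setUP[->|].
apply: injT; rewrite ?inT //; apply/eqP/trace_eqP=> a aA.
have aW := subsetP AW0 a aA.
by rewrite -fa // ff' // fyy' f'a.
Qed.

(** For x = [f y] in [W1], injectivity across maps gives x = [f1 y]. Whether [f' y] lies in [W1] or
    in the common difference, the same argument gives [f' y] = x, so x is in [W']. *)
Lemma embeds_agree_subset (W1 W W' : {set G}) (f1 f f' : G -> G) :
  embeds W0 W1 f1 -> embeds W0 W f -> embeds W0 W' f' ->
  {in A, f =1 f1} -> {in A, f' =1 f1} -> W :\: W1 = W' :\: W1 ->
  W \subset W'.
Proof.
move=> e1 e e' ff1 f'f1 D; apply/subsetP=> x xW.
have [xW1|xW1] := boolP (x \in W1); last first.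
  have : x \in W' :\: W1 by rewrite -D inE xW1.
  by case/setDP.
case: (e) (e1) (e') => fW _ _ [fW1 _ _] [fW' _ _].
move: (xW); rewrite -fW => /imsetP[y yW0 xf].
have xf1 : x = f1 y.
  move: xW1; rewrite -fW1 => /imsetP[y1 y1W0 xf1].
  by rewrite xf1 (embeds_agree_inj e e1 ff1 yW0 y1W0) // -xf.
have f'yW' : f' y \in W' by rewrite -fW' imset_f.
have [f'W1|f'W1] := boolP (f' y \in W1).
  move: f'W1; rewrite -fW1 => /imsetP[y3 y3W0 E].
  by rewrite xf1 (embeds_agree_inj e' e1 f'f1 yW0 y3W0 E) -E.
have : f' y \in W :\: W1 by rewrite D inE f'W1.
rewrite inE => /andP[_]; rewrite -{1}fW => /imsetP[y2 y2W0 E].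
have ff' : {in A, f' =1 f} by move=> a aA; rewrite ff1 ?f'f1.
have yy2 := embeds_agree_inj e' e ff' yW0 y2W0 E.
by rewrite xf yy2 -E.
Qed.

End EmbedsAgree.

(* Inside one isomorphism class, an embedding of a fixed member is determined
   up to [2 ^ q] choices by its restriction to A: sets W with the same
   restriction are transversals of the same trace classes, hence determined by
   their difference with any one of them. *)
Lemma card_family_le (G : sgraph) (A T : {set G}) q (F : {set {set G}}) :
  {in T &, injective (trace A)} ->
  {in F, forall W : {set G},
     [/\ A \subset W, W \subset A :|: T & #|(A :|: T) :\: W| <= q]} ->
  #|F| <= num_induced G * (#|G| ^ #|A| * 2 ^ q).
Proof.
move=> injT hF.
pose r (W1 W2 : {set G}) := `[< isomorphic (induced W1) (induced W2) >].
pose P := equivalence_partition r [set: {set G}].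
have r_equiv : {in [set: {set G}] & &, equivalence_rel r}.
  move=> X Y Z _ _ _; split; first by apply/asboolP; apply: isomorphic_refl.
  move=> /asboolP h; apply/asboolP/asboolP; apply: isomorphic_trans => //.
  exact: isomorphic_sym.
have /and3P[/eqP covP tP _] := equivalence_partitionP r_equiv.
have cls W : pblock P W \in P by rewrite pblock_mem // covP inE.
have clsE W W' : W' \in pblock P W -> isomorphic (induced W') (induced W).
  rewrite pblock_equivalence_partition ?inE // => /asboolP.
  exact: isomorphic_sym.
(* Representatives are taken inside [F], so they contain [A] and lie in [A :|: T]; the default
   occurs only for classes that miss [F]. *)
pose rep (c : {set {set G}}) : {set G} := odflt set0 [pick W in F | W \in c].
have repP W : W \in F -> rep (pblock P W) \in F /\
    isomorphic (induced (rep (pblock P W))) (induced W).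
  move=> WF; rewrite /rep; case: pickP => [W' /andP[W'F /clsE]|/(_ W)] //.
  by rewrite WF mem_pblock covP inE.
have [f fP] : {f : {set G} -> G -> G &
    forall W : {set G}, W \in F -> embeds (rep (pblock P W)) W (f W)}.
  apply: (boolp.choice (P := fun W h => W \in F -> embeds _ W h)) => W.
  have [WF|] := boolP (W \in F).
    have [_ /isomorphic_embeds[h eh]] := repP W WF.
    by exists h.
  by exists id.
(* There are at most [num_induced G * #|G| ^ #|A|] keys; each fibre is shown to have at most [2 ^ q]
   members. *)
pose key W := (pblock P W, [ffun a : {x | x \in A} => f W (val a)]).
have keyP W : W \in F -> key W \in setX P [set: {ffun {x | x \in A} -> G}].
  by move=> _; rewrite !inE cls.
rewrite -sum1_card (partition_big key _ keyP) /=.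
have -> : num_induced G * (#|G| ^ #|A| * 2 ^ q) =
    \sum_(k in setX P [set: {ffun {x | x \in A} -> G}]) 2 ^ q.
  by rewrite sum_nat_const cardsX cardsT card_ffun card_sig mulnA.
apply: leq_sum => k _; rewrite sum1dep_card.
have [->|[W1]] := set_0Vmem [set W in F | key W == k].
  by rewrite cards0.
rewrite inE => /andP[W1F /eqP kW1].
have [_ _ qW1] := hF W1 W1F.
(* Taking the difference with [W1] injects the fibre into the subsets of a set of at most [q]
   elements. *)
apply: (@leq_trans #|powerset ((A :|: T) :\: W1)|); last first.
  by rewrite card_powerset leq_exp2l.
have sub W W' : W \in F -> W' \in F -> key W = k -> key W' = k ->
    W :\: W1 = W' :\: W1 -> W \subset W'.
  move=> WF W'F kW kW' D.
  have cW : pblock P W = pblock P W1 by case: (kW1); rewrite -kW => -[].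
  have cW' : pblock P W' = pblock P W1 by case: (kW1); rewrite -kW' => -[].
  have agree V : key V = k -> {in A, f V =1 f W1}.
    move=> kV a aA; move: kW1; rewrite -kV => -[_ /ffunP/(_ (Sub a aA))].
    by rewrite !ffunE.
  have [repF _] := repP W1 W1F; have [AR RAT _] := hF _ repF.
  apply: (embeds_agree_subset injT AR RAT (fP W1 W1F) _ _
           (agree _ kW) (agree _ kW') D).
    by rewrite -cW; apply: fP.
  by rewrite -cW'; apply: fP.
rewrite -(@card_in_imset _ _ (fun W => W :\: W1)).
  apply: subset_leq_card; apply/subsetP=> _ /imsetP[W + ->].
  rewrite !inE => /andP[WF _]; have [_ WAT _] := hF W WF.
  exact: setSD.
move=> W W'; rewrite !inE => /andP[WF /eqP kW] /andP[W'F /eqP kW'] D.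
by apply/eqP; rewrite eqEsubset !sub.
Qed.

(* The family: remove from A :|: T at most one element of each of q triples
   that partition T. *)
Lemma num_induced_ge (G : sgraph) (A T : {set G}) q :
  [disjoint A & T] -> {in T &, injective (trace A)} -> #|T| = 3 * q ->
  4 ^ q <= num_induced G * (#|G| ^ #|A| * 2 ^ q).
Proof.
move=> dAT injT cT.
have ct : #|[set: 'I_q * 'I_3]| = #|T|.
  by rewrite cardsT card_prod !card_ord cT mulnC.
have [t tinj tT] : exists2 t : 'I_q * 'I_3 -> G, injective t & forall p, t p \in T.
  have lt (p : 'I_q * 'I_3) : enum_rank p < #|T|.
    by rewrite -ct cardsT.
  exists (fun p => enum_val (Ordinal (lt p))) => [p p' /enum_val_inj|p].
    by move=> [/ord_inj/enum_rank_inj].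
  exact: enum_valP.
(* [Some j] removes the element [j] of triple [i], and [None] removes nothing: four choices per
   triple. *)
pose D (phi : {ffun 'I_q -> option 'I_3}) :=
  [set t p | p in [pred p : 'I_q * 'I_3 | phi p.1 == Some p.2]].
pose w phi := (A :|: T) :\: D phi.
have DT phi : D phi \subset T by apply/subsetP=> _ /imsetP[p _ ->].
have memD phi p : (t p \in D phi) = (phi p.1 == Some p.2).
  by rewrite mem_imset.
have winj : injective w.
  move=> phi psi E; apply/ffunP=> i.
  have h j : (phi i == Some j) = (psi i == Some j).
    have := memD phi (i, j); have := memD psi (i, j) => /= <- <-.
    have := congr1 (fun B : {set G} => t (i, j) \in B) E.
    by rewrite /w !inE !tT orbT !andbT => /(congr1 negb); rewrite !negbK.
  case Ep: (phi i) => [j|].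
    by apply/esym/eqP; rewrite -h Ep.
  by case Es: (psi i) => [j|//]; have := h j; rewrite Ep Es eqxx.
have <- : #|[set w phi | phi in [set: {ffun 'I_q -> option 'I_3}]]| = 4 ^ q.
  by rewrite card_imset // cardsT card_ffun card_option !card_ord.
apply: (card_family_le injT) => _ /imsetP[phi _ ->]; split.
- rewrite /w subsetD subsetUl /=.
  by apply: disjointWr dAT; apply: DT.
- exact: subsetDl.
apply: (@leq_trans #|D phi|).
  apply: subset_leq_card; apply/subsetP=> x; rewrite /w !in_setD.
  by case: (x \in D phi) (x \in _ :|: _) => -[].
apply: (@leq_trans #|[set t (i, odflt ord0 (phi i)) | i : 'I_q]|).
  apply: subset_leq_card; apply/subsetP=> _ /imsetP[[i j] /= /eqP E ->].
  by apply/imsetP; exists i; rewrite ?E.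
by apply: leq_trans (leq_imset_card _ _) _; rewrite card_ord.
Qed.

Lemma exists_transversal (T U : finType) (h : T -> U) :
  exists2 S : {set T}, {in S &, injective h} & #|S| = #|h @: [set: T]|.
Proof.
(* The option type lets the choice exist even when [T] is empty. *)
have [s sP] : {s : U -> option T & forall u,
    u \in h @: [set: T] -> exists2 x, s u = Some x & h x = u}.
  apply: (boolp.choice
    (P := fun u o => u \in _ -> exists2 x, o = Some x & h x = u)) => u.
  have [/imsetP[x _ ->]|] := boolP (u \in _).
    by exists (Some x) => _; exists x.
  by exists None.
pose S := [set x | s (h x) == Some x].
have Sinj : {in S &, injective h}.
  by move=> x y; rewrite !inE => /eqP sx /eqP sy E; move: sx; rewrite E sy => -[].
exists S => //; rewrite -(card_in_imset Sinj); apply: eq_card => u.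
apply/imsetP/idP=> [[x _ ->]|uI]; first exact: imset_f.
have [x sx hx] := sP u uI.
by exists x; rewrite // inE hx sx.
Qed.

(** A transversal of the trace classes loses at most [#|A|] elements when made disjoint from [A]. *)
Lemma num_induced_ge_traces (G : sgraph) (A : {set G}) q :
  #|A| + 3 * q <= #|trace A @: [set: G]| ->
  4 ^ q <= num_induced G * (#|G| ^ #|A| * 2 ^ q).
Proof.
move=> h; have [S Sinj cS] := exists_transversal (trace A).
have [|T TS cT] := @subset_of_card _ (S :\: A) (3 * q).
  have := subset_leq_card (subsetIr S A).
  by move: h; rewrite -cS -(cardsID A S); lia.
apply: (@num_induced_ge G A T) => //.
  rewrite disjoint_sym; apply: disjointWl TS _.
  by rewrite disjoints_subset setDE subsetIr.
by move=> x y /(subsetP TS)/setDP[xS _] /(subsetP TS)/setDP[yS _]; apply: Sinj.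
Qed.

(** * Pairwise homogeneous pieces *)

Lemma separated_adj (G : sgraph) (J : {set {set G}}) (X Y : {set G})
    (x x' y y' : G) :
  separated J -> X \in J -> Y \in J -> X != Y ->
  x \in X -> x' \in X -> y \in Y -> y' \in Y -> adj x y = adj x' y'.
Proof.
have nsplit (v z z' : G) (Z : {set G}) :
    ~~ splits v Z -> z \in Z -> z' \in Z -> adj v z = adj v z'.
  rewrite negb_exists_in => /forall_inP h zZ z'Z.
  have := h z zZ; rewrite negb_exists_in => /forall_inP/(_ z' z'Z).
  by rewrite negbK => /eqP.
move=> sJ XJ YJ XY xX x'X yY y'Y.
transitivity (adj x y').
  by apply: nsplit yY y'Y; apply: sJ xX => //; rewrite eq_sym.
rewrite adj_sym [RHS]adj_sym.
by apply: nsplit xX x'X; apply: sJ y'Y.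
Qed.

Lemma separated_homogeneous (G : sgraph) (J : {set {set G}}) r u s k t :
  trivIset J -> separated J ->
  {in J, forall X : {set G}, #|X| = 4 ^ r} ->
  0 < u -> t <= u * k -> 2 * ((2 * u) ^ s * 2 ^ k) <= #|J| ->
  exists b (W : {set G}), homogeneous (@adj G) b W /\
    (r * s <= #|W| \/ t <= #|W|).
Proof.
move=> tJ sJ cJ u0 tuk QJ.
have [H hP] : {H : {set G} -> bool * {set G} & forall X, X \in J ->
    [/\ (H X).2 \subset X, homogeneous (@adj G) (H X).1 (H X).2
      & #|(H X).2| = r]}.
  apply: (boolp.choice (P := fun (X : {set G}) (bY : bool * {set G}) => X \in J ->
    [/\ bY.2 \subset X, homogeneous (@adj G) bY.1 bY.2 & #|bY.2| = r])) => X.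
  have [XJ|] := boolP (X \in J); last by exists (true, set0).
  have [|b [Y Yh]] := @ramsey_diagonal _ _ r X (@adj_sym G).
    by rewrite cJ.
  by exists (b, Y).
have half x y z : 2 * z <= x + y -> x < z -> z <= y by lia.
have [b Qb] : exists b, (2 * u) ^ s * 2 ^ k <= #|[set X in J | (H X).1 == b]|.
  have := cardsID [set X | (H X).1 == true] J.
  have -> : J :&: [set X | (H X).1 == true] = [set X in J | (H X).1 == true].
    by apply/setP=> X; rewrite !inE.
  have -> : J :\: [set X | (H X).1 == true] = [set X in J | (H X).1 == false].
    by apply/setP=> X; rewrite !inE andbC; case: (H X).1.
  have [h _|h E] := leqP ((2 * u) ^ s * 2 ^ k) #|[set X in J | (H X).1 == true]|.
    by exists true.
  by exists false; apply: half h; rewrite E.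
(* A single edge decides: distinct separated pieces are completely joined or completely unjoined. *)
pose e (X Y : {set G}) := [exists x in X, exists y in Y, adj x y] == b.
have eE X Y x y : X \in J -> Y \in J -> X != Y -> x \in X -> y \in Y ->
    e X Y = (adj x y == b).
  move=> XJ YJ XY xX yY; rewrite /e; congr (_ == _).
  apply/exists_inP/idP=> [[x' x'X /exists_inP[y' y'Y]]|xy].
    by rewrite (separated_adj sJ XJ YJ XY x'X xX y'Y yY).
  by exists x => //; apply/exists_inP; exists y.
have esym : symmetric e.
  move=> X Y; rewrite /e; congr (_ == _).
  by apply/exists_inP/exists_inP=> -[x xX /exists_inP[y yY xy]];
     exists y => //; apply/exists_inP; exists x => //; rewrite adj_sym.
have [V VJ] := ramsey_offdiagonal esym u0 tuk Qb.
have {}VJ X : X \in V -> X \in J /\ (H X).1 = b.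
  by move=> /(subsetP VJ); rewrite inE => /andP[? /eqP].
case=> -[hV cV].
- pose W := \bigcup_(X in V) (H X).2.
  exists b, W; split.
    move=> x y /bigcupP[X XV xX] /bigcupP[Y YV yY] xy.
    have [[XJ bX] [YJ bY]] := (VJ X XV, VJ Y YV).
    have [[sX hX _] [sY _ _]] := (hP X XJ, hP Y YJ).
    have [E|XY] := eqVneq X Y; first by rewrite -bX; apply: hX => //; rewrite E.
    have := hV X Y XV YV XY.
    by rewrite (eE X Y x y) ?(subsetP sX) ?(subsetP sY) // => /eqP.
  (* The union is counted piece by piece through [pblock J]. *)
  left; rewrite -cV mulnC -sum_nat_const -[X in _ <= X]sum1_card.
  rewrite (partition_big (pblock J) (mem V)) /=.
    apply: leq_sum => X XV; have [XJ _] := VJ X XV; have [sX _ <-] := hP X XJ.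
    rewrite sum1dep_card; apply: subset_leq_card; apply/subsetP=> x xX.
    rewrite inE (def_pblock tJ XJ (subsetP sX x xX)) eqxx andbT.
    by apply/bigcupP; exists X.
  move=> x /bigcupP[X XV xX]; have [XJ _] := VJ X XV; have [sX _ _] := hP X XJ.
  by rewrite (def_pblock tJ XJ (subsetP sX x xX)).
- have [p pP] : {p : {set G} -> option G & forall X, X \in J ->
      exists2 x, p X = Some x & x \in X}.
    apply: (boolp.choice
      (P := fun (X : {set G}) o => X \in J -> exists2 x, o = Some x & x \in X)) => X.
    have [XJ|] := boolP (X \in J); last by exists None.
    have : 0 < #|X| by rewrite cJ // expn_gt0.
    by move=> /card_gt0P[x xX]; exists (Some x) => _; exists x.
  pose W := [set x | Some x \in p @: V].
  have WP x : x \in W -> exists X, [/\ X \in V, X \in J, p X = Some x & x \in X].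
    rewrite inE => /imsetP[X XV E]; have [XJ _] := VJ X XV.
    by exists X; split=> //; have [x' ] := pP X XJ; rewrite -E => -[->].
  exists (~~ b), W; split.
    move=> x y /WP[X [XV XJ pX xX]] /WP[Y [YV YJ pY yY]] xy.
    have XY : X != Y by apply: contraNneq xy => E; move: pX; rewrite E pY => -[->].
    have := hV X Y XV YV XY; rewrite (eE X Y x y) //.
    by case: (adj x y) (b) => -[].
  right; rewrite -cV; apply: (@leq_trans #|pblock J @: W|); last first.
    exact: leq_imset_card.
  apply: subset_leq_card; apply/subsetP=> X XV; have [XJ _] := VJ X XV.
  have [x px xX] := pP X XJ; apply/imsetP; exists x.
    by rewrite inE -px imset_f.
  by rewrite (def_pblock tJ XJ xX).
Qed.

Lemma many_induced_or_homogeneous (G : sgraph) r u s k t q m g :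
  0 < u -> t <= u * k -> #|G| * trunc_log 2 #|G| < m * g.+1 ->
  2 * 4 ^ r * (m + 3 * q) <= #|G| ->
  4 * 4 ^ r * (2 * (4 ^ r * g)).+1 * ((2 * u) ^ s * 2 ^ k) <= #|G| ->
  4 ^ q <= num_induced G * (#|G| ^ m * 2 ^ q) \/
  exists b (W : {set G}), homogeneous (@adj G) b W /\
    (r * s <= #|W| \/ t <= #|W|).
Proof.
move=> u0 tuk mg mq Qn; set L := 4 ^ r in mq Qn.
have L0 : 0 < L by rewrite expn_gt0.
have Q0 : 0 < (2 * u) ^ s * 2 ^ k by rewrite muln_gt0 !expn_gt0 muln_gt0 u0.
have [A cA mA] := exists_small_minority mg.
(* Dichotomy on the number of traces of [A]. *)
have [h|h] := leqP (m + 3 * q) #|trace A @: [set: G]|.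
  left; apply: leq_trans (num_induced_ge_traces (A := A) _) _.
    by apply: leq_trans h; rewrite leq_add2r.
  rewrite leq_mul2l leq_mul2r leq_pexp2l ?orbT //.
  by apply: leq_trans Qn; rewrite !muln_gt0 L0 -muln_gt0 Q0.
right; have [I [tI _ hI nI]] := chop_fibers L0 (ltnW h).
have [||J JI [sJ cJ]] := @exists_separated G A I L g tI _ _ mA.
- by move=> X /hI[].
- by move=> X /hI[].
apply: (@separated_homogeneous G J r u s k t) => //.
- by apply/trivIsetP=> X Y XJ YJ; move/trivIsetP: tI; apply; apply: (subsetP JI).
- by move=> X /(subsetP JI)/hI[].
rewrite -(@leq_pmul2l (2 * L * (2 * (L * g)).+1)); last by rewrite !muln_gt0 L0.
apply: (@leq_trans #|G|); first by apply: leq_trans Qn; lia.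
move: nI; rewrite cardsT => nI.
(* By [mq], at most half of the vertices remain outside the pieces. *)
have n2 : #|G| <= 2 * L * #|I| by move: nI mq; lia.
apply: leq_trans n2 _; rewrite -[leqRHS]mulnA leq_mul2l cJ.
by rewrite orbT.
Qed.

(** * Growth estimates and choice of parameters *)

Lemma sq_le_exp4 K j : 8 * K <= j -> K * j.+1 ^ 2 <= 4 ^ j.
Proof.
move=> Kj; pose i := j %/ 2.
have i2 : i.+1 <= 2 ^ i by apply: ltn_expl.
have h1 : i.+1 ^ 4 <= 4 ^ j.
  apply: (@leq_trans ((2 ^ i) ^ 4)); first by rewrite leq_exp2r.
  rewrite (_ : 4 = 2 ^ 2) // -!expnM leq_exp2l //.
  by rewrite /i; lia.
apply: leq_trans h1; rewrite (expnD _ 2 2).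
apply: (@leq_trans (K * (2 * i.+1) ^ 2)).
  by rewrite leq_mul2l leq_exp2r // /i; apply/orP; right; lia.
rewrite expnMn mulnA leq_mul2r; apply/orP; right.
apply: (@leq_trans (4 * K)); first by lia.
by apply: (@leq_trans i.+1); [rewrite /i; lia | rewrite expnS leq_pmulr].
Qed.

(** For [l] about log n, this says that a polylogarithmic factor times about sqrt n stays below n.
    The constant 512 is 4 * 8 * 16: from [l] to [l %/ 4], from [sq_le_exp4], and from the square of
    4. *)
Lemma polylog_le_exp2 B l :
  512 * B <= l -> B * l.+1 ^ 2 * 2 ^ (2 * (l %/ 4)) <= 2 ^ l.
Proof.
move=> Bl; set j := l %/ 4.
have Kj : 16 * B * j.+1 ^ 2 <= 4 ^ j by apply: sq_le_exp4; rewrite /j; lia.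
apply: (@leq_trans (4 ^ j * 2 ^ (2 * j))); last first.
  rewrite (_ : 4 = 2 ^ 2) // -expnM -expnD leq_exp2l //.
  by rewrite /j; lia.
rewrite leq_mul2r; apply/orP; right; apply: leq_trans Kj.
rewrite (mulnC 16) -mulnA leq_mul2l; apply/orP; right.
rewrite (_ : 16 = 4 ^ 2) // -expnMn leq_exp2r //.
by rewrite /j; lia.
Qed.

(** With q = [n %/ (8 * L)], the number [m] is of order q / log n, so that n^m <= 2^(q/2), and [g]
    is then of order log^2 n. *)
Lemma exists_parameters L n l : 0 < L -> 32 * L * l.+1 <= n ->
  exists m g, [/\ n * l < m * g.+1, m * l.+1 <= n %/ (8 * L) %/ 2,
    2 * L * (m + 3 * (n %/ (8 * L))) <= n &
    (2 * (L * g)).+1 <= 128 * L ^ 2 * l.+1 ^ 2].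
Proof.
move=> L0 Ln; set q := n %/ (8 * L).
have qn : q * (8 * L) <= n by apply: leq_trunc_div.
have nq : n < q.+1 * (8 * L) by rewrite ltn_ceil // muln_gt0.
clearbody q.
have q4 : 4 * l.+1 <= q.
  rewrite -ltnS -(@ltn_pmul2r (8 * L)) ?muln_gt0 //.
  by apply: leq_ltn_trans nq; rewrite mulnACA (mulnC l.+1) mulnA.
pose m := q %/ 2 %/ l.+1.
have mq : m * l.+1 <= q %/ 2 by apply: leq_trunc_div.
have qm : q %/ 2 < m.+1 * l.+1 by rewrite ltn_ceil.
have m0 : 0 < m by rewrite /m divn_gt0 // leq_divRL //; lia.
clearbody m.
have qm' : q.+1 <= 8 * (l.+1 * m) by move: qm m0; nia.
have nm : n <= 64 * L * (l.+1 * m).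
  apply: ltnW; apply: leq_trans nq _.
  apply: (@leq_trans (8 * (l.+1 * m) * (8 * L))); last by lia.
  by rewrite leq_mul2r qm' orbT.
(* This is the least [g] with [n * l < m * g.+1]. *)
exists m, ((n * l) %/ m); split=> //.
- by rewrite [ltnRHS]mulnC ltn_ceil.
- have mq' : m <= q by move: mq; nia.
  by move: qn; nia.
apply: (@leq_trans (2 * (L * (64 * L * (l.+1 * l)))).+1).
  rewrite ltnS !leq_mul2l; apply/orP; right; apply/orP; right.
  rewrite -(@mulnK (64 * L * (l.+1 * l)) m) //; apply: leq_div2r.
  by apply: leq_trans (leq_mul nm (leqnn l)) _; lia.
rewrite -!mulnn; have : 0 < L * L by rewrite muln_gt0 L0.
by nia.
Qed.

Lemma induced_subgraphs_nat (C : nat) : 0 < C -> exists D N : nat, 0 < D /\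
  forall G : sgraph, N <= #|G| ->
  (forall b (W : {set G}), homogeneous (@adj G) b W ->
     #|W| < C * (trunc_log 2 #|G|).+1) ->
  2 ^ (#|G| %/ D) <= num_induced G.
Proof.
move=> C0.
have halves x : x %/ 2 + (x %/ 2 + x) <= 2 * x by lia.
have quarters x y : x + y + y.+1 = x.+1 + 2 * y by lia.
(* [e] is the Ramsey weight 2u for u = 4C; [r] is chosen so that [r * s] exceeds C (l + 1) when s is
   about l / (4e). *)
have [e eE] : {e | e = 8 * C} by exists (8 * C).
have [r rE] : {r | r = 4 * e * C} by exists (4 * e * C).
have [L LE] : {L | L = 4 ^ r} by exists (4 ^ r).
have L0 : 0 < L by rewrite LE expn_gt0.
have e0 : 0 < e by rewrite eE muln_gt0.
have [B BE] : {B | B = 4 * L * (128 * L ^ 2) * 2 ^ e.+1}.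
  by exists (4 * L * (128 * L ^ 2) * 2 ^ e.+1).
(* The divisor makes the exponent [q %/ 2]; the threshold forces [512 * B <= l]. *)
exists (16 * L), (2 ^ (512 * B)); split; first by rewrite muln_gt0.
move=> G; set n := #|G|; set l := trunc_log 2 n => Nn small.
have n0 : 0 < n by apply: leq_trans Nn; rewrite expn_gt0.
have ln : 2 ^ l <= n by apply: trunc_logP.
have nl : n < 2 ^ l.+1 by apply: trunc_log_ltn.
have lB : 512 * B <= l by apply: trunc_log_max.
have key := leq_trans (polylog_le_exp2 lB) ln.
have LB : 32 * L <= B.
  rewrite BE -mulnA (_ : 32 * L = 4 * L * 8); last by rewrite mulnAC.
  rewrite leq_mul2l; apply/orP; right.
  apply: (@leq_trans (128 * L ^ 2)); last by rewrite leq_pmulr // expn_gt0.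
  by apply: (@leq_trans (128 * 1)) => //; rewrite leq_mul2l expn_gt0 L0.
have Ll : 32 * L * l.+1 <= n.
  apply: leq_trans key; rewrite -[leqLHS]muln1; apply: leq_mul.
    by apply: leq_mul => //; rewrite -{1}(expn1 l.+1) leq_pexp2l.
  by rewrite expn_gt0.
have [m [g [mg mq mqn gg]]] := exists_parameters L0 Ll.
set q := n %/ (8 * L) in mq mqn.
have s_def : l < 4 * e * (l %/ (4 * e)).+1.
  by rewrite mulnC ltn_ceil // muln_gt0.
(* Since e^s <= 2^(e s), both Ramsey factors are O(n^(1/4)), so the number of pieces needed is
   O(sqrt n). *)
have [|||||h|[b [W [hW cW]]]] :=
    @many_induced_or_homogeneous G r (4 * C) (l %/ (4 * e)).+1 (l %/ 4).+1
      (C * l.+1) q m g.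
- by rewrite muln_gt0.
- by rewrite (mulnC 4) -mulnA leq_mul2l (mulnC 4) ltn_ceil ?orbT.
- exact: mg.
- by rewrite -LE.
- rewrite -LE; apply: leq_trans key.
  apply: (@leq_trans (4 * L * (128 * L ^ 2 * l.+1 ^ 2) *
                      (2 ^ (e + l %/ 4) * 2 ^ (l %/ 4).+1))).
    apply: leq_mul; first by rewrite leq_mul2l gg orbT.
    rewrite leq_mul2r; apply/orP; right.
    rewrite (_ : 2 * (4 * C) = e); last by rewrite eE mulnA.
    apply: (@leq_trans ((2 ^ e) ^ (l %/ (4 * e)).+1)).
      by rewrite leq_exp2r // ltnW // ltn_expl.
    rewrite -expnM leq_exp2l // mulnS leq_add2l divnMA mulnC.
    exact: leq_trunc_div.
  rewrite BE -expnD quarters expnD !mulnA leq_mul2r; apply/orP; right.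
  by rewrite mulnAC (mulnAC _ l.+1).
- have nm2 : n ^ m <= 2 ^ (q %/ 2).
    apply: (@leq_trans ((2 ^ l.+1) ^ m)).
      by rewrite leq_exp2r; [apply: ltnW | case: (m) mg].
    by rewrite -expnM leq_exp2l // mulnC.
  have -> : n %/ (16 * L) = q %/ 2.
    by rewrite /q -divnMA mulnAC.
  (* Dividing 4^q by 2^q and by n^m <= 2^(q/2) leaves at least 2^(q/2). *)
  rewrite -(@leq_pmul2r (2 ^ (q %/ 2) * 2 ^ q)); last by rewrite muln_gt0 !expn_gt0.
  apply: (@leq_trans (4 ^ q)).
    by rewrite (_ : 4 = 2 ^ 2) // -expnM -!expnD leq_exp2l // halves.
  by apply: leq_trans h _; rewrite -/n leq_mul2l leq_mul2r nm2 !orbT.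
- exfalso; have := small b W hW; rewrite ltnNge; apply/negP; rewrite negbK.
  case: cW => // h; apply: leq_trans h.
  by rewrite rE (mulnC _ C) -mulnA leq_mul2l s_def orbT.
Qed.

(** * Passage to real logarithms and exponents *)

Local Open Scope ring_scope.

Lemma log2_le_trunc_log (R : realType) (n : nat) :
  (0 < n)%N -> log2 n%:R <= (trunc_log 2 n).+1%:R :> R.
Proof.
move=> n0; have ln2 : 0 < ln 2 :> R by rewrite ln_gt0 // ltr1n.
rewrite /log2 ler_pdivrMr // mulrC mulr_natr -lnXn ?ltr0n //.
rewrite ler_ln ?posrE ?ltr0n ?exprn_gt0 ?ltr0n // -natrX ler_nat ltnW //.
exact: trunc_log_ltn.
Qed.

Theorem theorem1p2 (R : realType) (c1 : R) (hc1 : 0 < c1) :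
  exists c2 : R, 0 < c2 /\
  exists N : nat, forall n : nat, (N <= n)%N ->
  forall G : sgraph, #|G| = n ->
  ~ (exists W : {set G}, c1 * log2 n%:R <= #|W|%:R /\ complete_on W) ->
  ~ (exists W : {set G}, c1 * log2 n%:R <= #|W|%:R /\ edgeless_on W) ->
  2 `^ (c2 * n%:R) <= (num_induced G)%:R.
Proof.
pose C := (Num.truncn c1).+1.
have c1C : c1 <= C%:R by rewrite ltW // truncnS_gt.
have [D [N [D0 main]]] := @induced_subgraphs_nat C isT.
have D2 : 0 < (2 * D)%N%:R :> R by rewrite ltr0n muln_gt0.
(* For n >= [D] the integer quotient [n %/ D] is at least n / (2D). *)
exists (2 * D)%N%:R^-1; split; first by rewrite invr_gt0.
exists (maxn N D) => n; rewrite geq_max => /andP[Nn Dn] G Gn noK noE.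
have n0 : (0 < n)%N by apply: leq_trans Dn.
apply: (@le_trans _ _ (2 `^ (n %/ D)%:R)).
  apply: ler_powR; first by rewrite ler1n.
  rewrite mulrC ler_pdivrMr // -natrM ler_nat.
  have := ltn_ceil n D0; have : (0 < n %/ D)%N by rewrite divn_gt0.
  by nia.
rewrite powR_mulrn ?ler0n // -natrX ler_nat -Gn; apply: main.
  by rewrite Gn.
move=> b W hW; rewrite Gn ltnNge; apply/negP=> big.
have {}big : c1 * log2 n%:R <= #|W|%:R.
  apply: (@le_trans _ _ (C * (trunc_log 2 n).+1)%:R); last by rewrite ler_nat.
  rewrite natrM; apply: (@le_trans _ _ (c1 * (trunc_log 2 n).+1%:R)).
    by rewrite ler_pM2l // log2_le_trunc_log.
  by rewrite ler_wpM2r.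
case: b hW => hW; [apply: noK|apply: noE]; exists W; split=> // x y xW yW.
(* [edgeless_on] also covers equal pairs, which irreflexivity settles. *)
have [->|xy] := eqVneq x y; first by rewrite adj_irr.
by rewrite hW.
Qed.
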